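(* The generating function $\mathcal{X}_P(z)=\sum_{n\ge 0}X_{P_n}z^n$ of the chromatic symmetric functions of paths satisfies $$\mathcal{X}_P(z)=\frac{K(z)}{D(z)}+e_1z\,\frac{G(z)}{D(z)}+(1+e_1z).$$
   Context: The chromatic symmetric function of a finite simple graph $H=(V,E)$ is $X_H=\sum_\kappa\prod_{u\in V}x_{\kappa(u)}$, the sum over all proper colorings $\kappa:V\to\mathbb{Z}_{>0}$. $P_n$ is the path on $n$ vertices ($X_{P_0}=1$). $e_i$ is the $i$-th elementary symmetric function. Notation: $K(z)=\sum_{i\ge 2}ie_iz^i$, $G(z)=\sum_{i\ge 2}(i-1)e_iz^i$, $D(z)=1-G(z)$. *)

(* Defs.v *)
From HB Require Import structures.
From mathcomp Require Import all_boot all_order all_algebra finmap multiset.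
From mathcomp Require Import boolp classical_sets functions cardinality fsbigop.

Set Implicit Arguments.
Unset Strict Implicit.
Unset Printing Implicit Defensive.

Import GRing.Theory Num.Theory.

Local Open Scope classical_set_scope.
Local Open Scope ring_scope.

(* Commutative monoids, written additively, in which every element has        *)
(* finitely many decompositions as a sum of two elements: the exponent        *)
(* monoids over which formal power series can be multiplied.                  *)
HB.mixin Record isFinDecomp M of GRing.Nmodule M := {
  decomp : M -> {fset M * M};
  mem_decomp : forall m p, (p \in decomp m) = (p.1 + p.2 == m)
}.

#[short(type="finDecompType")]
HB.structure Definition FinDecomp := {M of isFinDecomp M & GRing.Nmodule M}.

(* Formal power series with exponents in M and coefficients in R.             *)
Record series (M R : Type) := Series { scoef :> M -> R }.

Lemma seriesP (M R : Type) (f g : series M R) : scoef f =1 scoef g <-> f = g.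
Proof.
split=> [|-> //]; case: f g => f [g] /= fg; congr Series; exact/funext.
Qed.

Lemma scoefK (M R : Type) : cancel (@scoef M R) (@Series M R).
Proof. by case. Qed.

HB.instance Definition _ (M : Type) (R : choiceType) :=
  Choice.copy (series M R) (can_type (@scoefK M R)).

Section SeriesRing.
Variables (M : finDecompType) (R : comNzRingType).
Implicit Types f g h : series M R.

Definition szero : series M R := Series (fun=> 0).
Definition sopp f : series M R := Series (fun m => - f m).
Definition sadd f g : series M R := Series (fun m => f m + g m).
Definition sone : series M R := Series (fun m => (m == 0)%:R).
Definition smul f g : series M R :=
  Series (fun m => \sum_(p <- decomp m) f p.1 * g p.2).

Fact saddA : associative sadd.
Proof. by move=> f g h; apply/seriesP => m /=; rewrite addrA. Qed.
Fact saddC : commutative sadd.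
Proof. by move=> f g; apply/seriesP => m /=; rewrite addrC. Qed.
Fact sadd0 : left_id szero sadd.
Proof. by move=> f; apply/seriesP => m /=; rewrite add0r. Qed.
Fact saddN : left_inverse szero sopp sadd.
Proof. by move=> f; apply/seriesP => m /=; rewrite addNr. Qed.

HB.instance Definition _ :=
  GRing.isZmodule.Build (series M R) saddA saddC sadd0 saddN.


Let L (m : M) : {fset M} := [fset p.1 | p in decomp m]%fset.

Let mem_L m a : reflect (exists b, a + b = m) (a \in L m).
Proof.
apply: (iffP idP) => [/imfsetP[[x b] /= + ->]|[b abm]].
  by rewrite mem_decomp => /eqP; exists b.
by apply/imfsetP; exists (a, b) => //=; rewrite mem_decomp /= abm.
Qed.

Let convE (s : {fset M}) f g m :
  (forall a b, a + b = m -> (a \in s) && (b \in s)) ->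
  smul f g m = \sum_(a <- s) \sum_(b <- s) (a + b == m)%:R * (f a * g b).
Proof.
move=> sP /=; rewrite -(big_allpairs (F := fun p : M * M =>
  (p.1 + p.2 == m)%:R * (f p.1 * g p.2))) /=.
under [RHS]eq_bigr => p _ do rewrite mulr_natl mulrb.
rewrite -big_mkcond -[RHS]big_filter /=; apply: perm_big; apply: uniq_perm => [|| [a b]].
- exact: fset_uniq.
- by rewrite filter_uniq // allpairs_uniq ?fset_uniq // => -[? ?] [? ?].
rewrite mem_decomp mem_filter /=.
apply/idP/idP => [/[dup] /eqP /sP/andP[aL bL] -> /=|/andP[]//].
by apply/allpairsP; exists (a, b).
Qed.

Let sub_L m c : c \in L m -> forall a b, a + b = c -> (a \in L m) && (b \in L m).
Proof.
move=> /mem_L[d <-] a b <-; apply/andP; split; apply/mem_L.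
  by exists (b + d); rewrite addrA.
by exists (a + d); rewrite addrCA addrA.
Qed.

Let L_top m : m \in L m. Proof. by apply/mem_L; exists 0; rewrite addr0. Qed.

Fact smulC : commutative smul.
Proof.
move=> f g; apply/seriesP => m; rewrite !(convE _ _ (sub_L (L_top m))).
rewrite exchange_big; apply: eq_bigr => a _; apply: eq_bigr => b _.
by rewrite addrC (mulrC (f b)).
Qed.

Let smul3E f g h m : smul f (smul g h) m =
  \sum_(a <- L m) \sum_(c <- L m) \sum_(d <- L m)
     (a + c + d == m)%:R * (f a * g c * h d).
Proof.
rewrite (convE _ _ (sub_L (L_top m))); apply: eq_big_seq => a aL.
transitivity (\sum_(b <- L m) \sum_(c <- L m) \sum_(d <- L m)
   (a + b == m)%:R * (f a * ((c + d == b)%:R * (g c * h d)))).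
  apply: eq_big_seq => b bL; rewrite (convE _ _ (sub_L bL)) !mulr_sumr.
  by apply: eq_bigr => c _; rewrite !mulr_sumr.
rewrite exchange_big; apply: eq_bigr => c _.
rewrite exchange_big; apply: eq_bigr => d _.
have [acd|nacd] := eqVneq (a + c + d) m; last first.
  rewrite mul0r big1 // => b _; have [cdb|] := eqVneq (c + d) b; last first.
    by rewrite !(mul0r, mulr0).
  by rewrite -cdb addrA (negbTE nacd) mul0r.
have cdL : c + d \in L m by apply/mem_L; exists a; rewrite addrC addrA.
rewrite (bigD1_seq (c + d)) ?fset_uniq //= big1 ?addr0; last first.
  by move=> b /negbTE; rewrite eq_sym => ->; rewrite !(mul0r, mulr0).
by rewrite addrA acd !eqxx !mul1r mulrA.
Qed.

Fact smulA : associative smul.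
Proof.
move=> f g h; rewrite [RHS]smulC; apply/seriesP => m; rewrite !smul3E.
rewrite [RHS]exchange_big; apply: eq_bigr => a _.
rewrite [RHS]exchange_big; apply: eq_bigr => c _; apply: eq_bigr => d _.
by rewrite (addrC d) addrAC (mulrC (h d)) (mulrAC (f a)).
Qed.

Fact smul1 : left_id sone smul.
Proof.
move=> f; apply/seriesP => m /=.
rewrite (bigD1_seq (0, m)) ?fset_uniq ?mem_decomp ?add0r //= eqxx mul1r.
rewrite big_seq_cond big1 ?addr0 // => -[a b] /=.
rewrite mem_decomp /= => /andP[/eqP <-].
by have [->|] := eqVneq a 0; rewrite ?mul0r // add0r eqxx.
Qed.

Fact smulDl : left_distributive smul sadd.
Proof.
move=> f g h; apply/seriesP => m /=; rewrite -big_split /=.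
by apply: eq_bigr => p _; rewrite mulrDl.
Qed.

Fact sone_neq0 : sone != szero.
Proof.
apply/eqP => /seriesP/(_ 0) /=; rewrite eqxx => /eqP.
by rewrite oner_eq0.
Qed.

HB.instance Definition _ := GRing.Zmodule_isComNzRing.Build (series M R)
  smulA smulC smul1 smulDl sone_neq0.

Lemma scoef0 m : (0 : series M R) m = 0. Proof. by []. Qed.
Lemma scoef1 m : (1 : series M R) m = (m == 0)%:R. Proof. by []. Qed.
Lemma scoefN f m : (- f) m = - f m. Proof. by []. Qed.
Lemma scoefD f g m : (f + g) m = f m + g m. Proof. by []. Qed.
Lemma scoefB f g m : (f - g) m = f m - g m. Proof. by []. Qed.
Lemma scoefM f g m : (f * g) m = \sum_(p <- decomp m) f p.1 * g p.2.
Proof. by []. Qed.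

Lemma scoef_sum (I : Type) (r : seq I) (P : pred I) (F : I -> series M R) m :
  (\sum_(i <- r | P i) F i) m = \sum_(i <- r | P i) F i m.
Proof. exact: (big_morph (fun f => scoef f m)). Qed.

(* Invertibility is decided classically and the inverse is obtained by        *)
(* choice; see [series_unit] for the series in one variable.                  *)
Definition sunit : pred (series M R) := fun f => `[< exists g, g * f = 1 >].
Definition sinv f : series M R :=
  if pselect (exists g, g * f = 1) is left ex then projT1 (cid ex) else f.

Fact smulV : {in sunit, left_inverse 1 sinv *%R}.
Proof.
move=> f /asboolP uf; rewrite /sinv; case: pselect => // ex.
by case: (cid ex).
Qed.

Fact sunitPl f g : g * f = 1 -> sunit f.
Proof. by move=> gf; apply/asboolP; exists g. Qed.

Fact sinv_out : {in [predC sunit], sinv =1 id}.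
Proof. by move=> f /asboolPn nuf; rewrite /sinv; case: pselect. Qed.

HB.instance Definition _ := GRing.ComNzRing_hasMulInverse.Build (series M R)
  smulV sunitPl sinv_out.

Definition smono (m : M) : series M R := Series (fun m' => (m' == m)%:R).

Definition sconst (c : R) : series M R :=
  Series (fun m => if m == 0 then c else 0).

(* The sum of a possibly infinite family of series. It is taken coefficient   *)
(* by coefficient, and is meaningful when each coefficient is nonzero in only *)
(* finitely many members of the family (otherwise that coefficient is 0).     *)
Definition ssum (I : choiceType) (A : set I) (F : I -> series M R) :
  series M R := Series (fun m => \sum_(i \in A) F i m).

Definition summable (I : choiceType) (A : set I) (F : I -> series M R) :=
  forall m, finite_set [set i | A i /\ F i m != 0].

Lemma smonoD a b : smono (a + b) = smono a * smono b.
Proof.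
apply/seriesP => m; rewrite scoefM /=.
have [->|nm] := eqVneq m (a + b).
  rewrite (bigD1_seq (a, b)) ?fset_uniq ?mem_decomp //= !eqxx mulr1.
  rewrite big1 ?addr0 // => -[c d]; rewrite xpair_eqE /=.
  by case: eqVneq => _; case: eqVneq => _ //=; rewrite ?mul0r ?mulr0.
rewrite big_seq big1 // => -[c d]; rewrite mem_decomp /= => /eqP cd.
case: eqVneq => [ca|]; case: eqVneq => [db|]; rewrite ?mul0r ?mulr0 //.
by move: nm; rewrite -cd ca db eqxx.
Qed.

Lemma smono0 : smono 0 = 1. Proof. by []. Qed.

Lemma smono_sum (I : Type) (r : seq I) (F : I -> M) :
  smono (\sum_(i <- r) F i) = \prod_(i <- r) smono (F i).
Proof. exact: (big_morph smono smonoD smono0). Qed.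

End SeriesRing.

Arguments smono {M R} m.
Arguments sconst {M R} c.

Fact mem_nat_decomp (n : nat) (p : nat * nat) :
  (p \in [fset (val i, n - i)%N | i : 'I_n.+1 in 'I_n.+1]%fset) =
  (p.1 + p.2 == n).
Proof.
apply/imfsetP/eqP => [[i _ ->]|pn] /=.
  by rewrite -[LHS]/(i + (n - i))%N subnKC // -ltnS.
have pi : (p.1 < n.+1)%N by rewrite ltnS -pn leq_addr.
exists (Ordinal pi) => //=; rewrite -pn.
by rewrite -[(p.1 + p.2)%R]/(p.1 + p.2)%N addKn; case: (p).
Qed.

HB.instance Definition _ := isFinDecomp.Build nat mem_nat_decomp.

Lemma scoefMn (R : comNzRingType) (f g : series nat R) n :
  (f * g) n = \sum_(i < n.+1) f i * g (n - i)%N.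
Proof.
rewrite scoefM /decomp /= big_imfset /=; last by move=> i j _ _ [] /val_inj.
by rewrite big_enum.
Qed.

Lemma series_unit (R : comNzRingType) (f : series nat R) :
  f 0%N = 1 -> f \is a GRing.unit.
Proof.
move=> f0; pose u := 1 - f.
have fE : f = 1 - u by rewrite /u opprB addrC subrK.
have u0 k n : (n < k)%N -> (u ^+ k) n = 0.
  elim: k n => // k IHk n nk; rewrite exprS scoefMn big1 // => -[[|i] /= ni] _.
    by rewrite f0 subrr mul0r.
  rewrite IHk ?mulr0 //; move: nk ni; rewrite !ltnS; case: n => // n nk ni.
  by rewrite subSS (leq_ltn_trans (leq_subr _ _)).
pose g : series nat R := Series (fun n => (\sum_(k < n.+1) u ^+ k) n).
have gE n N : (n <= N)%N -> g n = (\sum_(k < N.+1) u ^+ k) n.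
  move=> nN; rewrite /g /= !scoef_sum (big_ord_widen N.+1 (fun k => (u ^+ k) n)) //.
  rewrite big_mkcond; apply: eq_bigr => k _.
  by case: ltnP => // /u0 ->.
apply/unitrPr; exists g; apply/seriesP => n; rewrite mulrC.
transitivity (((\sum_(k < n.+1) u ^+ k) * f) n).
  rewrite !scoefMn; apply: eq_bigr => i _; congr (_ * _).
  by apply: gE; rewrite -ltnS.
have -> : (\sum_(k < n.+1) u ^+ k) * f = 1 - u ^+ n.+1.
  by rewrite fE mulrC -[RHS]opprB subrX1 -mulNr [- (u - 1)]opprB.
by rewrite scoefB u0 ?subr0.
Qed.

(* Monomials in x_1, x_2, ...; the exponent of x_(i+1) is the multiplicity of *)
(* i in the multiset, so that the naturals from 0 index the variables (and    *)
(* serve as the colors 1, 2, ... of a coloring).                              *)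
Definition xmono := {mset nat}%mset.

HB.instance Definition _ := Choice.on xmono.
HB.instance Definition _ := GRing.isNmodule.Build xmono
  (@msetDA nat) (@msetDC nat) (@mset0D nat).

Definition xmono_sub (m : xmono) : {fset xmono} :=
  [fset (seq_mset (mask (val t) (enum_mset m)) : xmono)
    | t : (size (enum_mset m)).-tuple bool in predT]%fset.

Fact mem_xmono_decomp (m : xmono) (p : xmono * xmono) :
  (p \in [fset q in xmono_sub m `*` xmono_sub m | (q.1 + q.2 == m)%R]%fset) =
  (p.1 + p.2 == m).
Proof.
have sub a b : a + b = m -> a \in xmono_sub m.
  move=> abm; have /count_subseqP[s /subseqP[t st ->] ast] :
      forall x, (count_mem x (enum_mset a) <= count_mem x (enum_mset m))%N.
    by move=> x; rewrite !count_mem_mset -abm msetE2 leq_addr.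
  have tP : size t == size (enum_mset m) by rewrite st.
  apply/imfsetP; exists (Tuple tP) => //=.
  by rewrite -[LHS]seq_mset_id; apply/eq_seq_msetP.
rewrite !inE /=; apply: andb_idl => /eqP pm; apply/andP; split.
  exact: sub pm.
by apply: (sub _ p.1); rewrite addrC.
Qed.

HB.instance Definition _ := isFinDecomp.Build xmono mem_xmono_decomp.

(* Symmetric functions are elements of the ring of integral formal power      *)
(* series in x_1, x_2, ..., and their generating functions are power series   *)
(* in z over that ring.                                                       *)
Notation xseries := (series xmono int).
Notation zseries := (series nat xseries).

Definition xvar (i : nat) : xseries := smono ([mset i]%mset : xmono).

Definition zvar : zseries := smono 1%N.

Definition elem_sym (k : nat) : xseries :=
  ssum [set S : {fset nat} | #|` S| = k] (fun S => \prod_(i <- S) xvar i).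

Record sgraph := SGraph {
  vertex :> finType;
  adj : rel vertex;
  adj_sym : symmetric adj;
  adj_irrefl : irreflexive adj
}.

Definition proper_coloring (H : sgraph) (kappa : {ffun H -> nat}) : Prop :=
  forall u v : H, adj u v -> kappa u != kappa v.

Definition chromatic_sym (H : sgraph) : xseries :=
  ssum [set kappa | proper_coloring kappa]
    (fun kappa : {ffun H -> nat} => \prod_(u : H) xvar (kappa u)).

Definition path_adj (n : nat) : rel 'I_n :=
  fun i j => (i.+1 == j :> nat) || (j.+1 == i :> nat).

Fact path_adj_sym n : symmetric (@path_adj n).
Proof. by move=> i j; rewrite /path_adj orbC. Qed.

Fact path_adj_irrefl n : irreflexive (@path_adj n).
Proof. by move=> i; rewrite /path_adj !(gtn_eqF (ltnSn _)). Qed.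

Definition path_graph (n : nat) : sgraph :=
  SGraph (@path_adj_sym n) (@path_adj_irrefl n).

Definition path_gf : zseries := Series (fun n => chromatic_sym (path_graph n)).

Definition K_z : zseries :=
  Series (fun i => if (2 <= i)%N then i%:R * elem_sym i else 0).

Definition G_z : zseries :=
  Series (fun i => if (2 <= i)%N then i.-1%:R * elem_sym i else 0).

Definition D_z : zseries := 1 - G_z.

Lemma D_z_unit : D_z \is a GRing.unit.
Proof. by apply: series_unit; rewrite scoefB /= subr0. Qed.

Lemma prod_xE (I : Type) (r : seq I) (c : I -> nat) (m : xmono) :
  (\prod_(i <- r) xvar (c i)) m = (m == \sum_(i <- r) ([mset c i]%mset : xmono))%:R.
Proof. by rewrite -smono_sum. Qed.

Lemma mem_sum_mset (I : eqType) (r : seq I) (c : I -> nat) i : i \in r ->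
  c i \in (\sum_(i <- r) ([mset c i]%mset : xmono) : {mset nat}%mset).
Proof.
elim: r => // j r IHr; rewrite inE big_cons in_msetD => /orP[/eqP ->|/IHr ->].
  by rewrite in_mset1 eqxx.
by rewrite orbT.
Qed.

Lemma elem_sym_summable k :
  summable [set S : {fset nat} | #|` S| = k] (fun S => \prod_(i <- S) xvar i).
Proof.
move=> m; apply: (@sub_finite_set _ _ [set` fpowerset (finsupp m)]) => //.
move=> S /= [_]; rewrite prod_xE pnatr_eq0 eqb0 negbK => /eqP ->.
rewrite fpowersetE; apply/fsubsetP => i iS; rewrite msuppE.
exact: (mem_sum_mset id).
Qed.

Lemma chromatic_sym_summable (H : sgraph) :
  summable [set kappa | proper_coloring kappa]
    (fun kappa : {ffun H -> nat} => \prod_(u : H) xvar (kappa u)).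
Proof.
move=> m; pose N := (\max_(i <- finsupp m) i).+1.
apply: (@sub_finite_set _ _
  [set [ffun u => val (f u)] | f in [set: {ffun H -> 'I_N}]]).
  move=> k /= [_]; rewrite prod_xE pnatr_eq0 eqb0 negbK => /eqP mE.
  have kN u : (k u < N)%N.
    rewrite ltnS; apply: (@leq_bigmax_seq _ _ xpredT id) => //.
    by rewrite msuppE mE; apply: mem_sum_mset; rewrite mem_index_enum.
  exists [ffun u => Ordinal (kN u)] => //.
  by apply/ffunP => u; rewrite !ffunE.
exact: finite_image.
Qed.

(* Main.v *)
Require Import Defs.
From HB Require Import structures.
From mathcomp Require Import all_boot all_order all_algebra finmap multiset.
From mathcomp Require Import boolp classical_sets functions cardinality fsbigop.
From mathcomp Require Import ring.

(* Let Theta = z d/dz and E(z) = sum e_n z^n = prod_c (1 + x_c z). Then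
   D = E - Theta E and K - G + 1 + e_1 z = E, so the claim is X_P * D = E.
   If W_c enumerates the proper colorings of nonempty paths whose first color
   is c, removing the first vertex gives W_c = x_c z (X_P - W_c); hence
   Theta E * X_P = E * sum_c x_c z / (1 + x_c z) * X_P = E * sum_c W_c
   = E * (X_P - 1).  The computation is done with finitely many colors; this
   suffices, since the coefficient of a monomial m in either side only involves
   the colors that occur in m. *)

Set Implicit Arguments.
Unset Strict Implicit.
Unset Printing Implicit Defensive.

Import GRing.Theory Num.Theory.

Local Open Scope classical_set_scope.
Local Open Scope ring_scope.

(** * The derivation z d/dz on power series in z *)

Section EulerDerivation.
Variable R : comNzRingType.
Implicit Types f g : series nat R.

Definition theta f : series nat R := Series (fun n => n%:R * f n).

Lemma scoef_theta f n : theta f n = n%:R * f n. Proof. by []. Qed.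

Lemma thetaM f g : theta (f * g) = theta f * g + f * theta g.
Proof.
apply/seriesP => n; rewrite scoefD scoef_theta !scoefMn mulr_sumr -big_split /=.
(* The weight n splits as i + (n - i), which gives the two Leibniz terms. *)
apply: eq_bigr => i _; rewrite -{1}(subnKC (n := n) (m := i)) ?natrD; last first.
  by rewrite -ltnS.
ring.
Qed.

Lemma theta1 : theta 1 = 0.
Proof. by apply/seriesP => -[|n]; rewrite /= ?mul0r ?mulr0. Qed.

Lemma scoef_mulz f (a : R) n :
  (sconst a * smono 1%N * f) n = if n is n'.+1 then a * f n' else 0.
Proof.
have az k : (sconst a * smono 1%N : series nat R) k = if k == 1%N then a else 0.
  rewrite scoefMn big_ord_recl /= big1 ?addr0 ?subn0 //.
    by case: ifP; rewrite ?mulr1 ?mulr0.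
  by move=> i _; rewrite mul0r.
move: (_ * _ : series nat R) az => g az; rewrite scoefMn; case: n => [|n].
  by rewrite big_ord1 az mul0r.
rewrite big_ord_recl az mul0r add0r big_ord_recl az eqxx /=.
rewrite big1 ?addr0 ?subSS ?subn0 //.
by move=> i _; rewrite az mul0r.
Qed.

Lemma thetaD1z a :
  theta (1 + sconst a * smono 1%N) = sconst a * smono 1%N.
Proof.
(* The factor 1 lets [scoef_mulz] give the coefficients of a z itself. *)
rewrite -[sconst a * _]mulr1; apply/seriesP => n.
rewrite scoef_theta scoefD !scoef_mulz !scoef1; case: n => [|[|n]] /=.
- by rewrite mul0r.
- by rewrite mul1r mulr1 add0r.
- by rewrite mulr0 addr0 mulr0.
Qed.

Lemma scoef_prod_mulz (I : Type) (r : seq I) (P : pred I) (a : I -> R) n :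
  (\prod_(i <- r | P i) (sconst (a i) * smono 1%N) : series nat R) n =
  (n == count P r)%:R * \prod_(i <- r | P i) a i.
Proof.
elim: r n => [|i r IHr] n; first by rewrite !big_nil mulr1.
rewrite !big_cons /=; case: (P i) => //; rewrite scoef_mulz.
by case: n => [|n]; rewrite ?mul0r // IHr eqSS mulrCA.
Qed.

End EulerDerivation.

(** * Proper words over a finite alphabet *)

Section FiniteAlphabet.
Variables (R : comNzRingType) (T : finType) (x : T -> R).

Definition proper_word n (f : {ffun 'I_n -> T}) : bool :=
  [forall u, forall v, path_adj u v ==> (f u != f v)].

(** The existential makes this false for the empty word, so that [start_gf] has no constant term. *)
Definition starts_with (c : T) n (f : {ffun 'I_n -> T}) : bool :=
  [exists u : 'I_n, (u == 0 :> nat) && (f u == c)].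

Definition word_cons n (c : T) (f : {ffun 'I_n -> T}) : {ffun 'I_n.+1 -> T} :=
  [ffun i => if unlift ord0 i is Some j then f j else c].

Definition word_behead n (f : {ffun 'I_n.+1 -> T}) : {ffun 'I_n -> T} :=
  [ffun i => f (lift ord0 i)].

Lemma word_consK n c : cancel (@word_cons n c) (@word_behead n).
Proof. by move=> f; apply/ffunP => i; rewrite !ffunE liftK. Qed.

Lemma word_beheadK n (f : {ffun 'I_n.+1 -> T}) :
  word_cons (f ord0) (word_behead f) = f.
Proof.
by apply/ffunP => i; rewrite !ffunE; case: unliftP => [j|] ->; rewrite ?ffunE.
Qed.

Lemma word_cons0 n c (f : {ffun 'I_n -> T}) : word_cons c f ord0 = c.
Proof. by rewrite ffunE unlift_none. Qed.

Lemma word_cons_lift n c (f : {ffun 'I_n -> T}) i :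
  word_cons c f (lift ord0 i) = f i.
Proof. by rewrite ffunE liftK. Qed.

Lemma starts_withS c n (f : {ffun 'I_n.+1 -> T}) :
  starts_with c f = (f ord0 == c).
Proof.
apply/existsP/idP => [[u /andP[/eqP u0]]|fc]; last by exists ord0.
by rewrite (_ : u = ord0) //; apply/val_inj.
Qed.

(** Besides the adjacencies inside [f], the only new one joins [c] to the first letter of [f]. It is
    absent when [f] is empty, in accordance with [starts_with]. *)
Lemma proper_word_cons n c (f : {ffun 'I_n -> T}) :
  proper_word (word_cons c f) = proper_word f && ~~ starts_with c f.
Proof.
apply/'forall_forallP/andP => [pf|[/'forall_forallP pf /existsPn sf] u v].
  split.
    apply/'forall_forallP => u v; have := pf (lift ord0 u) (lift ord0 v).
    by rewrite !word_cons_lift.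
  apply/existsPn => u; have /implyP := pf ord0 (lift ord0 u).
  rewrite word_cons0 word_cons_lift /path_adj /= => cu.
  by case: eqP => //= u0; rewrite eq_sym cu // /bump u0.
apply/implyP.
case: (unliftP ord0 u) => [i|] ->; case: (unliftP ord0 v) => [j|] ->;
  rewrite ?word_cons0 ?word_cons_lift //.
- by move=> ij; exact: (implyP (pf i j)).
- rewrite /path_adj /= /bump /= add1n eqSS => i0.
  by have := sf i; rewrite eq_sym i0 /=.
- rewrite /path_adj /= /bump /= add1n orbF eqSS => j0.
  by have := sf j; rewrite eq_sym j0 eq_sym.
Qed.

Definition word_weight n (f : {ffun 'I_n -> T}) : R := \prod_u x (f u).

Definition word_gf : series nat R :=
  Series (fun n => \sum_(f : {ffun 'I_n -> T} | proper_word f) word_weight f).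

Definition start_gf c : series nat R :=
  Series (fun n =>
    \sum_(f : {ffun 'I_n -> T} | proper_word f && starts_with c f) word_weight f).

Definition letter_z c : series nat R := sconst (x c) * smono 1%N.

Lemma start_gfE c : start_gf c = letter_z c * (word_gf - start_gf c).
Proof.
apply/seriesP => -[|n]; rewrite scoef_mulz.
  by rewrite /= big1 // => f /andP[_ /existsP[[]]].
(* The difference leaves the proper words of length n that do not start with [c]; prepending [c]
   matches them with the proper words of length n + 1 that do. *)
rewrite scoefB /= [X in X - _](bigID (@starts_with c n)) /= addrAC subrr add0r.
under eq_bigl => f do rewrite starts_withS.
rewrite (reindex_onto (@word_cons n c) (@word_behead n)) /=; last first.
  by move=> f /andP[_ /eqP <-]; exact: word_beheadK.
rewrite mulr_sumr; apply: eq_big => f.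
  by rewrite word_consK word_cons0 !eqxx !andbT proper_word_cons.
move=> _; rewrite /word_weight big_ord_recl word_cons0.
by congr (_ * _); apply: eq_bigr => i _; rewrite word_cons_lift.
Qed.

Lemma word_gfE : word_gf = 1 + \sum_c start_gf c.
Proof.
apply/seriesP => -[|n]; rewrite scoefD scoef_sum scoef1 /=.
  rewrite [X in _ + X]big1 ?addr0; last first.
    by move=> c _; rewrite big1 // => f /andP[_ /existsP[[]]].
  (* There is exactly one word of length 0, and it is proper. *)
  have e0 (f g : {ffun 'I_0 -> T}) : f = g by apply/ffunP => -[].
  rewrite (big_pred1 (ffun0 (card_ord 0) : {ffun 'I_0 -> T})).
    by rewrite /word_weight big_ord0.
  move=> f /=; rewrite [RHS](introT eqP (e0 _ _)).
  by apply/forallP => -[].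
rewrite add0r (partition_big (fun f : {ffun 'I_n.+1 -> T} => f ord0) xpredT) //=.
by apply: eq_bigr => c _; apply: eq_bigl => f; rewrite starts_withS.
Qed.

Definition esym_gf (s : seq T) : series nat R := \prod_(c <- s) (1 + letter_z c).

(** This is the logarithmic derivative of a product, cleared of denominators. An arbitrary list [s]
    allows induction on the factors by the Leibniz rule. *)
Lemma theta_esym_gf s :
  theta (esym_gf s) * word_gf = esym_gf s * \sum_(c <- s) start_gf c.
Proof.
rewrite /esym_gf; elim: s => [|c s IHs].
  by rewrite !big_nil theta1 mul0r mulr0.
rewrite !big_cons thetaM thetaD1z -/(letter_z c) mulrDl.
rewrite -[_ * theta _ * _]mulrA IHs.
(* The equation [start_gfE] rearranged; it stands in for a division by 1 + x_c z. *)
have : letter_z c * word_gf = (1 + letter_z c) * start_gf c.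
  by rewrite mulrDl mul1r {1}start_gfE mulrBr subrK.
move: (letter_z c) (start_gf c) => z w zX; rewrite mulrAC zX; ring.
Qed.

Lemma word_gf_theta (E := esym_gf (index_enum T)) :
  word_gf * (E - theta E) = E.
Proof.
rewrite mulrBr [_ * theta _]mulrC theta_esym_gf -/E {1}word_gfE; ring.
Qed.

Lemma scoef_esym_gf n : esym_gf (index_enum T) n =
  \sum_(A : {set T} | #|A| == n) \prod_(c in A) x c.
Proof.
(* With the z-term first, [bigA_distr] sums over the sets of letters whose z-term is chosen. *)
rewrite /esym_gf; under eq_bigr do rewrite addrC.
rewrite bigA_distr scoef_sum [RHS]big_mkcond; apply: eq_bigr => A _.
rewrite -big_mkcond /= scoef_prod_mulz.
rewrite (_ : count _ _ = #|A|); last first.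
  by rewrite -sum1_count sum1_card.
by rewrite eq_sym; case: eqP; rewrite ?mul1r ?mul0r.
Qed.

End FiniteAlphabet.

(** * Restriction to finitely many variables *)

Lemma fsbig_finType (V : nmodType) (I : choiceType) (J : finType) (A : set I)
    (P : pred J) (h : J -> I) (F : I -> V) :
    injective h -> (forall j, P j -> A (h j)) ->
    (forall i, A i -> F i != 0 -> exists2 j, P j & h j = i) ->
  \sum_(i \in A) F i = \sum_(j | P j) F (h j).
Proof.
move=> hI PA AP; have PE i : i \in [seq h j | j <- enum P] -> A i.
  by move=> /mapP[j +] ->; rewrite mem_enum => /PA.
(* The last hypothesis makes this list cover the support of [F] in [A]. *)
rewrite (fsbigE [seq h j | j <- enum P]) ?map_inj_uniq ?enum_uniq //; last first.
  move=> i Ai; apply: contraNeq => /(AP i Ai)[j Pj <-].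
  by rewrite map_f // mem_enum.
rewrite -[LHS]big_filter (_ : filter _ _ = [seq h j | j <- enum P]); last first.
  by apply/all_filterP/allP => i /PE Ai; rewrite inE.
by rewrite big_map big_enum.
Qed.

Definition elem_gf : zseries := Series elem_sym.

Section Truncation.
Variable N : nat.

Definition below (m : xmono) : Prop :=
  forall i, i \in (m : {mset nat}%mset) -> (i < N)%N.

(** Equality after the variables of index at least [N] are set to 0. *)
Definition agree (f g : xseries) : Prop := forall m, below m -> f m = g m.

Lemma belowD a b : below (a + b) -> below a /\ below b.
Proof.
by move=> ab; split=> i im; apply: ab; rewrite in_msetD im ?orbT.
Qed.

Lemma below_sum (I : eqType) (r : seq I) (c : I -> nat) :
  below (\sum_(i <- r) ([mset c i]%mset : xmono)) ->
  forall i, i \in r -> (c i < N)%N.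
Proof. by move=> b i ir; apply: b; exact: mem_sum_mset. Qed.

(** Every factor of a monomial below [N] is itself below [N], so the convolution only meets
    coefficients on which the factors agree. *)
Lemma agreeM f g f' g' : agree f f' -> agree g g' -> agree (f * g) (f' * g').
Proof.
move=> ff gg m bm; rewrite !scoefM; apply: eq_big_seq => -[a b].
rewrite mem_decomp /= => /eqP ab; move: bm; rewrite -ab.
by case/belowD => /ff -> /gg ->.
Qed.

Definition zagree (f g : zseries) : Prop := forall n, agree (f n) (g n).

Lemma zagreeM f g f' g' : zagree f f' -> zagree g g' ->
  zagree (f * g) (f' * g').
Proof.
move=> ff gg n m bm; rewrite !scoefMn !scoef_sum; apply: eq_bigr => i _.
by apply: agreeM.
Qed.

Lemma zagreeB f g f' g' : zagree f f' -> zagree g g' ->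
  zagree (f - g) (f' - g').
Proof. by move=> ff gg n m bm; rewrite !scoefB ff // gg. Qed.

Lemma zagree_theta f g : zagree f g -> zagree (theta f) (theta g).
Proof. by move=> fg n; rewrite !scoef_theta; apply: agreeM. Qed.

Let x (i : 'I_N) : xseries := xvar i.

(** A coloring that contributes to a monomial below [N] uses only colors below [N], so it is in the
    image of [h], which forgets the bound. *)
Lemma path_gf_trunc : zagree path_gf (word_gf x).
Proof.
move=> n m bm; rewrite /= scoef_sum.
pose h (f : {ffun 'I_n -> 'I_N}) : {ffun 'I_n -> nat} := [ffun u => val (f u)].
rewrite (fsbig_finType (P := @proper_word _ n) (h := h)).
- apply: eq_bigr => f _; rewrite /word_weight /x.
  by under [in RHS]eq_bigr => u _ do rewrite -(ffunE (fun u => val (f u))).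
- move=> f g /ffunP fg; apply/ffunP => u; apply/val_inj.
  by have := fg u; rewrite !ffunE.
- move=> f /'forall_forallP pf u v uv; rewrite !ffunE.
  exact: (implyP (pf u v)).
move=> k pk; rewrite prod_xE pnatr_eq0 eqb0 negbK => /eqP mE.
have kN u : (k u < N)%N.
  by move: bm; rewrite mE => /below_sum; apply; rewrite mem_index_enum.
exists [ffun u => Ordinal (kN u)].
  apply/'forall_forallP => u v; apply/implyP => uv; rewrite !ffunE.
  exact: (pk u v uv).
by apply/ffunP => u; rewrite !ffunE.
Qed.

(** The same argument for index sets: a contributing set has all its elements below [N], hence comes
    from a subset of ['I_N]. *)
Lemma elem_gf_trunc : zagree elem_gf (esym_gf x (index_enum 'I_N)).
Proof.
move=> n m bm; rewrite scoef_esym_gf scoef_sum /=.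
pose h (A : {set 'I_N}) : {fset nat} := [fset val i | i in A]%fset.
have hE A i : (i \in h A) = [exists j in A, val j == i].
  apply/imfsetP/existsP => [[j /= jA ->]|[j /andP[jA /eqP <-]]].
    by exists j; rewrite jA eqxx.
  by exists j.
have hv A (j : 'I_N) : (val j \in h A) = (j \in A).
  rewrite hE; apply/existsP/idP => [[k /andP[kA /eqP/val_inj <- //]]|jA].
  by exists j; rewrite jA eqxx.
rewrite (fsbig_finType (P := fun A : {set 'I_N} => #|A| == n) (h := h)).
- apply: eq_bigr => A _; congr (scoef _ m).
  by rewrite big_imfset /= ?big_enum // => i j _ _ /val_inj.
- by move=> A B /fsetP AB; apply/setP => j; rewrite -!hv AB.
- move=> A /eqP <- /=; rewrite card_imfset //=; last exact: val_inj.
  by rewrite cardE.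
move=> S /= Sn; rewrite prod_xE pnatr_eq0 eqb0 negbK => /eqP mE.
have SN i : i \in S -> (i < N)%N.
  by move: bm; rewrite mE => /(@below_sum _ _ id); apply.
have hS : h [set j | val j \in S]%SET = S.
  apply/fsetP => i; rewrite hE; apply/existsP/idP => [[j]|iS].
    by rewrite inE => /andP[jS /eqP <-].
  by exists (Ordinal (SN i iS)); rewrite inE /= iS eqxx.
exists [set j | val j \in S]%SET => //.
rewrite -Sn -{2}hS card_imfset /=; last exact: val_inj.
by rewrite cardE.
Qed.

End Truncation.

(** * Back to infinitely many variables, and the closed formula *)

Lemma elem_sym0 : elem_sym 0 = 1.
Proof.
apply/seriesP => m; rewrite /= (_ : [set S | _] = [set fset0]).
  by rewrite fsbig_set1 big_seq_fset0.
apply/seteqP; split=> S /= => [/eqP|->]; last by rewrite cardfs0.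
by rewrite cardfs_eq0 => /eqP.
Qed.

Lemma D_zE : D_z = elem_gf - theta elem_gf.
Proof.
apply/seriesP => n; rewrite scoefB scoefB scoef_theta scoef1 /=.
(* [G_z] starts in degree 2. Below that, (1 - n) e_n is 1 for n = 0, since e_0 = 1, and 0 for n =
   1. *)
case: n => [|[|n]] /=.
- by rewrite elem_sym0 mul0r.
- by rewrite mul1r !subrr.
- by rewrite (mulrS 1 n.+1) mulrDl mul1r opprD addrA subrr.
Qed.

Lemma path_gf_mulD : path_gf * D_z = elem_gf.
Proof.
rewrite D_zE; apply/seriesP => n; apply/seriesP => m.
(* The number of colors depends on the monomial: [N] exceeds every index that occurs in [m]. *)
pose N := (\max_(i <- finsupp m) i).+1.
have bm : below N m.
  move=> i im; rewrite ltnS; apply: (@leq_bigmax_seq _ _ xpredT id) => //.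
  by rewrite msuppE.
have En := @elem_gf_trunc N.
rewrite (zagreeM (@path_gf_trunc N) (zagreeB En (zagree_theta En))) //.
by rewrite word_gf_theta En.
Qed.

(** From degree 2 on, n e_n - (n - 1) e_n = e_n; the terms 1 and e_1 z supply degrees 0 and 1. *)
Lemma elem_gfE : elem_gf = K_z - G_z + 1 + sconst (elem_sym 1) * zvar.
Proof.
rewrite -[sconst _ * _]mulr1 /zvar.
apply/seriesP => n; rewrite !scoefD scoefN scoef_mulz !scoef1.
case: n => [|[|n]] /=.
- by rewrite elem_sym0 subrr add0r addr0.
- by rewrite subrr !add0r mulr1.
- by rewrite (mulrS 1 n.+1) mulrDl mul1r mulr0 !addr0 addrK.
Qed.

Theorem corollary3p4 :
  path_gf = K_z / D_z + sconst (elem_sym 1) * zvar * (G_z / D_z)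
            + (1 + sconst (elem_sym 1) * zvar).
Proof.
(* Multiplying by the unit D clears both quotients and leaves K - G + 1 + e_1 z = K + e_1 z G + (1 +
   e_1 z)(1 - G). *)
apply: (mulIr D_z_unit); rewrite path_gf_mulD elem_gfE.
rewrite !mulrDl !mulrA !(mulrVK D_z_unit) /D_z.
ring.
Qed.
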